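(* Let $m$ and $n$ be integers such that $2\leq n\leq m$. (a) Consider the injective homomorphism $\iota\colon B_n\to B_m$ defined by $\iota(\sigma_i)=\sigma_i$ for all $1\leq i\leq n-1$. Then the induced homomorphism $\overline{\iota}\colon B_n/[P_n,P_n]\to B_m/[P_m,P_m]$ of the corresponding quotient groups is injective. (b) If $n\geq 3$ and $n$ is odd then $B_m/[P_m,P_m]$ possesses elements of order $n$. Further, there exists such an element whose permutation is an $n$-cycle. (c) Let $n_1,n_2,\ldots,n_t$ be odd integers greater than or equal to $3$ for which $\sum_{i=1}^{t} n_i\leq m$. Then $B_m/[P_m,P_m]$ possesses elements of order $\operatorname{lcm}(n_1,\ldots,n_t)$. Further, there exists such an element whose permutation has cycle type $(n_1,\ldots,n_t)$.
   Context: $B_n$ is the Artin braid group with generators $\sigma_1,\ldots,\sigma_{n-1}$ and relations $\sigma_i\sigma_j=\sigma_j\sigma_i$ for $|i-j|\geq 2$, and $\sigma_{i+1}\sigma_i\sigma_{i+1}=\sigma_i\sigma_{i+1}\sigma_i$ for $1\leq i\leq n-2$. $\sigma\colon B_n\to S_n$ is the homomorphism to the symmetric group with $\sigma(\sigma_i)=(i,i+1)$, $P_n=\ker\sigma$ is the pure braid group, $[P_n,P_n]$ is its commutator subgroup, and $\overline{\sigma}\colon B_n/[P_n,P_n]\to S_n$ is the induced homomorphism. The permutation of an element of $B_m/[P_m,P_m]$ is its image under $\overline{\sigma}$ in $S_m$, and its cycle type is that of this permutation, with fixed points omitted from the list. *)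

(* Defs.v *)
From HB Require Import structures.
From mathcomp Require Import all_boot all_fingroup.
From mathcomp Require Import zify generic_quotient boolp classical_sets.

Set Implicit Arguments.
Unset Strict Implicit.
Unset Printing Implicit Defensive.

Local Open Scope group_scope.
Local Open Scope quotient_scope.

(* A letter (a, true) stands for the generator a, (a, false) for its inverse. *)
Definition word (T : Type) := seq (T * bool).

Definition winv (T : Type) (w : word T) : word T :=
  rev [seq (p.1, ~~ p.2) | p <- w].

Definition weval (T : Type) (G : groupType) (f : T -> G) (w : word T) : G :=
  \prod_(p <- w) (if p.2 then f p.1 else (f p.1)^-1).

Inductive pres_eq (T : Type) (R : word T -> word T -> Prop) :
    word T -> word T -> Prop :=
| pres_rel u v : R u v -> pres_eq R u v
| pres_free a b : pres_eq R [:: (a, b); (a, ~~ b)] [::]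
| pres_cat u u' v v' :
    pres_eq R u u' -> pres_eq R v v' -> pres_eq R (u ++ v) (u' ++ v')
| pres_refl u : pres_eq R u u
| pres_sym u v : pres_eq R u v -> pres_eq R v u
| pres_trans v u w : pres_eq R u v -> pres_eq R v w -> pres_eq R u w.

Section PresentedGroup.
Variables (T : choiceType) (R : word T -> word T -> Prop).

Definition pres_eqb : rel (word T) := fun u v => `[< pres_eq R u v >].

Lemma pres_eqb_refl : reflexive pres_eqb.
Proof. by move=> u; apply/asboolP/pres_refl. Qed.

Lemma pres_eqb_sym : symmetric pres_eqb.
Proof. by move=> u v; apply: asbool_equiv_eq; split; apply: pres_sym. Qed.

Lemma pres_eqb_trans : transitive pres_eqb.
Proof.
by move=> v u w /asboolP uv /asboolP vw; apply/asboolP; apply: pres_trans uv vw.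
Qed.

Canonical pres_equiv :=
  EquivRel pres_eqb pres_eqb_refl pres_eqb_sym pres_eqb_trans.

Definition presented := {eq_quot pres_equiv}.

HB.instance Definition _ := Choice.on presented.
HB.instance Definition _ := EqQuotient.on presented.

Implicit Types x y z : presented.

Lemma pres_piP (u v : word T) :
  \pi_presented u = \pi_presented v <-> pres_eq R u v.
Proof.
by split=> [/eqP|uv]; [rewrite piE => /asboolP | apply/eqP; rewrite piE; apply/asboolP].
Qed.

Lemma pres_repr (u : word T) : pres_eq R (repr (\pi_presented u)) u.
Proof. by apply/pres_piP; rewrite reprK. Qed.

Lemma pres_winvl w : pres_eq R (winv w ++ w) [::].
Proof.
elim: w => [|[a b] w IHw]; first exact: pres_refl.
rewrite /winv /= rev_cons -cats1 -catA /= -[(a, ~~ b) :: _]/([:: _; _] ++ w).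
apply: pres_trans IHw; apply: pres_cat; first exact: pres_refl.
rewrite -[X in pres_eq R _ X]cat0s; apply: pres_cat; last exact: pres_refl.
by have := pres_free R a (~~ b); rewrite negbK.
Qed.

Lemma pres_winvr w : pres_eq R (w ++ winv w) [::].
Proof.
elim/last_ind: w => [|w [a b] IHw]; first exact: pres_refl.
rewrite /winv map_rcons rev_rcons -cats1 -catA /=.
rewrite -[(a, b) :: _]/([:: (a, b); (a, ~~ b)] ++ winv w).
apply: pres_trans IHw; apply: pres_cat; first exact: pres_refl.
rewrite -[X in pres_eq R _ X]cat0s; apply: pres_cat; last exact: pres_refl.
exact: pres_free.
Qed.

Definition pres_mul x y : presented := \pi_presented (repr x ++ repr y).
Definition pres_one : presented := \pi_presented [::].
Definition pres_inv x : presented := \pi_presented (winv (repr x)).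

Lemma pres_mulE (u v : word T) :
  pres_mul (\pi_presented u) (\pi_presented v) = \pi_presented (u ++ v).
Proof. by apply/pres_piP; apply: pres_cat; apply: pres_repr. Qed.

Lemma pres_mulA : associative pres_mul.
Proof.
elim/quotW=> u; elim/quotW=> v; elim/quotW=> w.
by rewrite (pres_mulE v w) (pres_mulE u v) !pres_mulE catA.
Qed.

Lemma pres_mul1 : left_id pres_one pres_mul.
Proof. by elim/quotW=> u; rewrite (pres_mulE [::] u). Qed.

Lemma pres_1mul : right_id pres_one pres_mul.
Proof. by elim/quotW=> u; rewrite (pres_mulE u [::]) cats0. Qed.

Lemma pres_mulV : left_inverse pres_one pres_inv pres_mul.
Proof.
move=> x; rewrite -{2}[x]reprK (pres_mulE (winv _) (repr x)).
exact/pres_piP/pres_winvl.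
Qed.

Lemma pres_Vmul : right_inverse pres_one pres_inv pres_mul.
Proof.
move=> x; rewrite -{1}[x]reprK (pres_mulE (repr x) (winv _)).
exact/pres_piP/pres_winvr.
Qed.

HB.instance Definition _ :=
  isGroup.Build presented pres_mulA pres_mul1 pres_1mul pres_mulV pres_Vmul.

Definition pres_gen (a : T) : presented := \pi_presented [:: (a, true)].

End PresentedGroup.

Lemma weval_cat (T : Type) (G : groupType) (f : T -> G) (u v : word T) :
  weval f (u ++ v) = weval f u * weval f v.
Proof. exact: big_cat. Qed.

Section PresentedLift.
Variables (T : choiceType) (R : word T -> word T -> Prop) (G : groupType).
Variable f : T -> G.

(* The morphism from the presented group sending each generator a to f a;
   meaningful only when f respects the relators (see [pres_liftE]). *)
Definition pres_lift (x : presented R) : G := weval f (repr x).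

Hypothesis fR : forall u v, R u v -> weval f u = weval f v.

Lemma weval_pres_eq u v : pres_eq R u v -> weval f u = weval f v.
Proof.
elim=> {u v}[||u u' v v' _ eu _ ev|//|//|v u w _ -> //]; first exact: fR.
- move=> a [] ; rewrite /weval !big_cons big_nil /= mulg1 ?mulgV ?mulVg //.
- by rewrite !weval_cat eu ev.
Qed.

Lemma pres_liftE (u : word T) : pres_lift (\pi_(presented R) u) = weval f u.
Proof. exact/weval_pres_eq/pres_repr. Qed.

Lemma pres_lift_gen a : pres_lift (pres_gen R a) = f a.
Proof. by rewrite pres_liftE /weval big_seq1. Qed.

Lemma pres_liftM : {morph pres_lift : x y / x * y}.
Proof.
move=> x y; rewrite -[x]reprK -[y]reprK.
by rewrite [X in pres_lift X]pres_mulE !pres_liftE weval_cat.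
Qed.

Lemma pres_lift1 : pres_lift 1 = 1.
Proof. by rewrite [LHS]pres_liftE /weval big_nil. Qed.

End PresentedLift.

Lemma presented_ind (T : choiceType) (R : word T -> word T -> Prop)
    (P : presented R -> Prop) :
  P 1 -> (forall x y, P x -> P y -> P (x * y)) -> (forall x, P x -> P x^-1) ->
  (forall a, P (pres_gen R a)) -> forall x, P x.
Proof.
move=> P1 PM PV Pg; elim/quotW; elim=> [|[a b] w IHw] //.
rewrite -cat1s -(pres_mulE R [:: (a, b)] w); apply: PM => //.
case: b; [exact: Pg|have := PV _ (Pg a); congr P].
apply: (mulgI (pres_gen R a)); rewrite mulgV.
rewrite [RHS](pres_mulE R [:: (a, true)] [:: (a, false)]).
by apply/pres_piP/pres_sym/pres_free.
Qed.

Record normal_subgroup (G : groupType) := NormalSubgroup {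
  nsub :> set G;
  nsub1 : nsub 1;
  nsubM : forall x y, nsub x -> nsub y -> nsub (x * y);
  nsubV : forall x, nsub x -> nsub x^-1;
  nsubJ : forall x y, nsub x -> nsub (x ^ y)
}.

Section QuotientGroup.
Variables (G : groupType) (N : normal_subgroup G).

Definition eqmodN : rel G := fun x y => `[< nsub N (x^-1 * y) >].

Lemma eqmodN_refl : reflexive eqmodN.
Proof. by move=> x; apply/asboolP; rewrite mulVg; apply: nsub1. Qed.

Lemma eqmodN_sym : symmetric eqmodN.
Proof.
by move=> x y; apply: asbool_equiv_eq; split=> /nsubV; rewrite invgM invgK.
Qed.

Lemma eqmodN_trans : transitive eqmodN.
Proof.
move=> y x z /asboolP Nxy /asboolP Nyz; apply/asboolP.
by have := nsubM Nxy Nyz; rewrite mulgA mulgK.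
Qed.

Canonical eqmodN_equiv :=
  EquivRel eqmodN eqmodN_refl eqmodN_sym eqmodN_trans.

Definition quot := {eq_quot eqmodN_equiv}.

HB.instance Definition _ := Choice.on quot.
HB.instance Definition _ := EqQuotient.on quot.

Implicit Types x y z : G.

Lemma quot_piP x y : \pi_quot x = \pi_quot y <-> nsub N (x^-1 * y).
Proof.
split=> [/eqP|Nxy]; first by rewrite piE => /asboolP.
by apply/eqP; rewrite piE; apply/asboolP.
Qed.

Lemma quot_repr x : nsub N ((repr (\pi_quot x))^-1 * x).
Proof. by apply/quot_piP; rewrite reprK. Qed.

Definition quot_mul (a b : quot) : quot := \pi_quot (repr a * repr b).
Definition quot_one : quot := \pi_quot 1.
Definition quot_inv (a : quot) : quot := \pi_quot (repr a)^-1.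

Lemma quot_mulE x y : quot_mul (\pi_quot x) (\pi_quot y) = \pi_quot (x * y).
Proof.
apply/quot_piP; set x' := repr _; set y' := repr _.
have -> : (x' * y')^-1 * (x * y) = (x'^-1 * x) ^ y' * (y'^-1 * y).
  by rewrite conjgE invgM !mulgA mulgK.
by apply: nsubM; [apply: nsubJ|]; apply: quot_repr.
Qed.

Lemma quot_mulA : associative quot_mul.
Proof.
elim/quotW=> x; elim/quotW=> y; elim/quotW=> z.
by rewrite (quot_mulE y z) (quot_mulE x y) !quot_mulE mulgA.
Qed.

Lemma quot_mul1 : left_id quot_one quot_mul.
Proof. by elim/quotW=> x; rewrite (quot_mulE 1 x) mul1g. Qed.

Lemma quot_1mul : right_id quot_one quot_mul.
Proof. by elim/quotW=> x; rewrite (quot_mulE x 1) mulg1. Qed.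

Lemma quot_mulV : left_inverse quot_one quot_inv quot_mul.
Proof. by move=> a; rewrite -{2}[a]reprK (quot_mulE (repr a)^-1) mulVg. Qed.

Lemma quot_Vmul : right_inverse quot_one quot_inv quot_mul.
Proof. by move=> a; rewrite -{1}[a]reprK (quot_mulE (repr a)) mulgV. Qed.

HB.instance Definition _ :=
  isGroup.Build quot quot_mulA quot_mul1 quot_1mul quot_mulV quot_Vmul.

Definition quot_pi (x : G) : quot := \pi_quot x.

Lemma quot_piM : {morph quot_pi : x y / x * y}.
Proof. by move=> x y; rewrite -[LHS]quot_mulE. Qed.

HB.instance Definition _ :=
  isUMagmaMorphism.Build G quot quot_pi (erefl, quot_piM).

Section Lift.
Variables (H : groupType) (f : UMagmaMorphism.type G H).

(* The morphism induced by f; meaningful only when f kills N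
   (see [quot_liftE]). *)
Definition quot_lift (a : quot) : H := f (repr a).

Hypothesis fN : forall x, nsub N x -> f x = 1.

Lemma quot_liftE x : quot_lift (quot_pi x) = f x.
Proof.
have /fN := quot_repr x; rewrite gmulfM gmulfV => /eqP.
by rewrite -(inj_eq (mulgI (f (repr (\pi_quot x))))) mulVKg mulg1 => /eqP ->.
Qed.

Lemma quot_liftM : {morph quot_lift : a b / a * b}.
Proof.
elim/quotW=> x; elim/quotW=> y.
rewrite -[\pi_quot x]/(quot_pi x) -[\pi_quot y]/(quot_pi y).
by rewrite -quot_piM !quot_liftE gmulfM.
Qed.

Lemma quot_lift1 : quot_lift 1 = 1.
Proof. by rewrite -[1]/(quot_pi 1) quot_liftE gmulf1. Qed.

End Lift.
End QuotientGroup.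

Definition kernel (G H : groupType) (f : G -> H) : set G :=
  [set x | f x = 1]%classic.

Inductive derived (G : groupType) (K : set G) : G -> Prop :=
| derivedR x y : K x -> K y -> derived K [~ x, y]
| derived1 : derived K 1
| derivedM x y : derived K x -> derived K y -> derived K (x * y)
| derivedV x : derived K x -> derived K x^-1.

Lemma derivedJ (G : groupType) (K : set G) :
  (forall x y, K x -> K (x ^ y)) ->
  forall x y, derived K x -> derived K (x ^ y).
Proof.
move=> KJ x y; elim=> {x}[x z Kx Kz||x z _ IHx _ IHz|x _ IHx].
- by rewrite conjRg; apply: derivedR; apply: KJ.
- by rewrite conj1g; apply: derived1.
- by rewrite conjMg; apply: derivedM.
- by rewrite conjVg; apply: derivedV.
Qed.

Lemma kernelJ (G H : groupType) (f : UMagmaMorphism.type G H) x y :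
  kernel f x -> kernel f (x ^ y).
Proof. by rewrite /kernel /= gmulfJ => ->; rewrite conj1g. Qed.

(* The commutator subgroup [ker f, ker f], as a normal subgroup of G. *)
Definition derived_kernel (G H : groupType) (f : UMagmaMorphism.type G H) :
    normal_subgroup G :=
  NormalSubgroup (derived1 (kernel f)) (@derivedM _ _) (@derivedV _ _)
    (derivedJ (@kernelJ _ _ f)).

Lemma derived_sub (G H : groupType) (f : UMagmaMorphism.type G H)
    (K : set G) (N : normal_subgroup H) :
  (forall x y, K x -> K y -> nsub N [~ f x, f y]) ->
  forall x, derived K x -> nsub N (f x).
Proof.
move=> fK x; elim=> {x}[x y Kx Ky||x y _ Nx _ Ny|x _ Nx].
- by rewrite gmulfR; apply: fK.
- by rewrite gmulf1; apply: nsub1.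
- by rewrite gmulfM; apply: nsubM.
- by rewrite gmulfV; apply: nsubV.
Qed.

Section Braid.
Variable n : nat.

(* 'I_n.-1 indexes the generators of B_n and 'I_n the strands; both indices
   start from 0, so the i-th generator exchanges the strands i and i.+1. *)
Inductive braid_rel : word 'I_n.-1 -> word 'I_n.-1 -> Prop :=
| braid_far (i j : 'I_n.-1) : (i.+1 < j)%N || (j.+1 < i)%N ->
    braid_rel [:: (i, true); (j, true)] [:: (j, true); (i, true)]
| braid_near (i j : 'I_n.-1) : j = i.+1 :> nat ->
    braid_rel [:: (j, true); (i, true); (j, true)]
              [:: (i, true); (j, true); (i, true)].

Definition braid := presented braid_rel.

HB.instance Definition _ := Group.on braid.

Definition braid_gen (i : 'I_n.-1) : braid := pres_gen braid_rel i.

Lemma strand_subproof (i : 'I_n.-1) : (i.+1 < n)%N.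
Proof. by rewrite -ltn_predRL ltn_ord. Qed.

Definition strand (i : 'I_n.-1) : 'I_n := widen_ord (leq_pred n) i.
Definition strandS (i : 'I_n.-1) : 'I_n := Ordinal (strand_subproof i).

Definition braid_perm : braid -> {perm 'I_n} :=
  pres_lift (fun i => tperm (strand i) (strandS i)).

Lemma braid_perm_rel u v : braid_rel u v ->
  weval (fun i => tperm (strand i) (strandS i)) u =
  weval (fun i => tperm (strand i) (strandS i)) v.
Proof.
case=> {u v}[i j ij|i j ij]; rewrite /weval !big_cons !big_nil /= !mulg1.
  rewrite conjgC tpermJ !tpermD // -val_eqE /=; lia.
have -> : strand j = strandS i by apply/val_inj.
have ac : strandS i != strandS j by rewrite -val_eqE /= ij; lia.
have ab : strand i != strandS j by rewrite -val_eqE /= ij; lia.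
have bc : strand i != strandS i by rewrite -val_eqE /=; lia.
rewrite -[X in X * _]tpermV -[X in _ = X * _]tpermV -!conjgE !tpermJ.
by rewrite tpermL tpermR !tpermD // eq_sym.
Qed.

Lemma braid_perm_monoid_morphism : monoid_morphism braid_perm.
Proof. by split; [apply: pres_lift1|apply: pres_liftM]; apply: braid_perm_rel. Qed.

HB.instance Definition _ :=
  isUMagmaMorphism.Build braid {perm 'I_n} braid_perm braid_perm_monoid_morphism.

Lemma braid_perm_gen i :
  braid_perm (braid_gen i) = tperm (strand i) (strandS i).
Proof. exact/pres_lift_gen/braid_perm_rel. Qed.

Definition pure_braid : set braid := kernel braid_perm.

Definition braid_quot := quot (derived_kernel braid_perm).

HB.instance Definition _ := Group.on braid_quot.

Definition braid_pi : braid -> braid_quot := quot_pi (derived_kernel braid_perm).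

HB.instance Definition _ := UMagmaMorphism.on braid_pi.

(* The permutation of an element of B_n / [P_n, P_n]. *)
Definition braid_quot_perm : braid_quot -> {perm 'I_n} := quot_lift braid_perm.

Lemma braid_quot_permE x : braid_quot_perm (braid_pi x) = braid_perm x.
Proof.
apply: quot_liftE => y; elim=> {y}[y z Py Pz||y z _ IHy _ IHz|y _ IHy].
- by rewrite gmulfR Py Pz commg1.
- exact: gmulf1.
- by rewrite gmulfM IHy IHz mulg1.
- by rewrite gmulfV IHy invg1.
Qed.

End Braid.

Section Iota.
Variables (n m : nat) (le_nm : (n <= m)%N).

Lemma leq_pred_nm : (n.-1 <= m.-1)%N.
Proof. by lia. Qed.

Definition iota_braid : braid n -> braid m :=
  pres_lift (fun i => braid_gen (widen_ord leq_pred_nm i)).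

Lemma iota_braid_rel u v : braid_rel u v ->
  weval (fun i => braid_gen (widen_ord leq_pred_nm i)) u =
  weval (fun i => braid_gen (widen_ord leq_pred_nm i)) v.
Proof.
case=> {u v}[i j ij|i j ij]; rewrite /weval !big_cons !big_nil /= !mulg1.
  rewrite [LHS]pres_mulE [RHS]pres_mulE; apply/pres_piP/pres_rel.
  exact: braid_far.
rewrite [X in _ * X]pres_mulE [X in _ = _ * X]pres_mulE.
rewrite [LHS]pres_mulE [RHS]pres_mulE; apply/pres_piP/pres_rel.
exact: braid_near.
Qed.

Lemma iota_braid_monoid_morphism : monoid_morphism iota_braid.
Proof. by split; [apply: pres_lift1|apply: pres_liftM]; apply: iota_braid_rel. Qed.

HB.instance Definition _ :=
  isUMagmaMorphism.Build (braid n) (braid m) iota_braid iota_braid_monoid_morphism.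

Lemma iota_braid_gen i :
  iota_braid (braid_gen i) = braid_gen (widen_ord leq_pred_nm i).
Proof. exact/pres_lift_gen/iota_braid_rel. Qed.

Lemma iota_braid_perm (x : braid n) :
  (forall k : 'I_n, braid_perm (iota_braid x) (widen_ord le_nm k) =
                    widen_ord le_nm (braid_perm x k)) /\
  (forall k : 'I_m, (n <= k)%N -> braid_perm (iota_braid x) k = k).
Proof.
elim/presented_ind: x => [|x y [x1 x2] [y1 y2]|x [x1 x2]|i].
- by split=> k *; rewrite !gmulf1 !perm1.
- by split=> k *; rewrite !gmulfM !permM ?x1 ?y1 ?x2 ?y2.
- split=> k *; rewrite !gmulfV; apply: (@perm_inj _ (braid_perm (iota_braid x))).
    by rewrite x1 !permKV.
  by rewrite permKV x2.
- rewrite iota_braid_gen !braid_perm_gen.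
  have -> : strand (widen_ord leq_pred_nm i) = widen_ord le_nm (strand i).
    exact/val_inj.
  have -> : strandS (widen_ord leq_pred_nm i) = widen_ord le_nm (strandS i).
    exact/val_inj.
  split=> k *; first by rewrite -inj_tperm // => a b /(congr1 val)/= /val_inj.
  by rewrite tpermD // -val_eqE /=; have := strand_subproof i; lia.
Qed.

Lemma iota_braid_pure x :
  pure_braid x -> pure_braid (iota_braid x).
Proof.
have [x1 x2] := iota_braid_perm x; rewrite /pure_braid /kernel /= => Px.
apply/permP=> k; rewrite perm1.
have [kn|/x2//] := ltnP k n.
have -> : k = widen_ord le_nm (Ordinal kn) by apply/val_inj.
by rewrite x1 Px perm1.
Qed.

(* The morphism B_n / [P_n, P_n] -> B_m / [P_m, P_m] induced by iota. *)
Definition iota_quot : braid_quot n -> braid_quot m :=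
  quot_lift (@braid_pi m \o iota_braid).

Lemma iota_quotE x : iota_quot (braid_pi x) = braid_pi (iota_braid x).
Proof.
apply: (@quot_liftE _ _ _ (@braid_pi m \o iota_braid)) => y /= Dy.
rewrite -[1]/(braid_pi 1); apply/esym/quot_piP; rewrite invg1 mul1g.
apply: derived_sub Dy => z t Pz Pt.
by apply: derivedR; apply: iota_braid_pure.
Qed.

End Iota.

Definition has_order (G : groupType) (x : G) (k : nat) : Prop :=
  [/\ (0 < k)%N, x ^+ k = 1 & forall j, (0 < j < k)%N -> x ^+ j <> 1].

(* The cycle type, up to reordering and with the fixed points omitted. *)
Definition cycle_type (T : finType) (s : {perm T}) : seq nat :=
  [seq #|X| | X : {set T} <- enum (porbits s) & (1 < #|X|)%N].

(* Main.v *)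
(* B_n maps to the semidirect product of Z^{ordered pairs} and S_n: sigma_k goes
   to the basis vector e_(k,k+1) together with its transposition.  The vector
   part lk x i j counts with signs the crossings where strand i passes over
   strand j (sigma_k being the crossing where the left strand is over).  This morphism kills [P_n, P_n]; it is faithful on
   B_n / [P_n, P_n] because P_n is the normal closure of the sigma_k^2 (Coxeter
   presentation of S_n) and a conjugate of sigma_k^2 depends, modulo [P_n, P_n],
   only on the pair of strands it twists, so that an element of P_n / [P_n, P_n]
   is determined by its crossing numbers.  Injectivity (a) follows, since adding
   trivial strands preserves crossing numbers.  The image consists of the (v, w)
   with v(i,j) - v(j,i) = [i < j] - [w i < w j].  If w has odd order, it preserves
   a tournament t; with f(i,j) = 1 when i < j and t orients the pair the other
   way, v(i,j) = f(i,j) - f(w i, w j) satisfies this condition, and the pair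
   (v, w) is conjugate to (0, w), hence has the order of w. *)
Require Import Defs.
From HB Require Import structures.
From mathcomp Require Import all_boot all_fingroup.
From mathcomp Require Import ssralg ssrint cyclic zify generic_quotient boolp.

Set Implicit Arguments.
Unset Strict Implicit.
Unset Printing Implicit Defensive.

(** * The semidirect product of integer vectors on ordered pairs with permutations *)

Section CrossingGroup.
Local Open Scope group_scope.
Variable n : nat.

Definition crossing_group : Type := ({ffun 'I_n * 'I_n -> int} * {perm 'I_n})%type.

HB.instance Definition _ := Choice.on crossing_group.

Implicit Types x y z : crossing_group.

(* In [x * y] the permutation of [x] acts first, so the strands numbered [i, j]
   at the top of [x] enter [y] at positions [x.2 i, x.2 j]. *)
Definition crossing_mul x y : crossing_group :=
  ([ffun p => x.1 p + y.1 (x.2 p.1, x.2 p.2)]%R, x.2 * y.2).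
Definition crossing_one : crossing_group := (0%R, 1).
Definition crossing_inv x : crossing_group :=
  ([ffun p => - x.1 (x.2^-1%g p.1, x.2^-1%g p.2)]%R, x.2^-1).

Lemma crossing_mulA : associative crossing_mul.
Proof.
move=> x y z; congr pair; last exact: mulgA.
by apply/ffunP=> p; rewrite !ffunE /= !permM GRing.addrA.
Qed.

Lemma crossing_mul1g : left_id crossing_one crossing_mul.
Proof.
case=> v w; congr pair; last exact: mul1g.
by apply/ffunP=> -[i j]; rewrite !ffunE /= !perm1 GRing.add0r.
Qed.

Lemma crossing_mulg1 : right_id crossing_one crossing_mul.
Proof.
case=> v w; congr pair; last exact: mulg1.
by apply/ffunP=> p; rewrite !ffunE /= GRing.addr0.
Qed.

Lemma crossing_mulVg : left_inverse crossing_one crossing_inv crossing_mul.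
Proof.
case=> v w; congr pair; last exact: mulVg.
by apply/ffunP=> p; rewrite !ffunE /= GRing.addNr.
Qed.

Lemma crossing_mulgV : right_inverse crossing_one crossing_inv crossing_mul.
Proof.
case=> v w; congr pair; last exact: mulgV.
by apply/ffunP=> -[i j]; rewrite !ffunE /= !permK GRing.addrN.
Qed.

HB.instance Definition _ := isGroup.Build crossing_group
  crossing_mulA crossing_mul1g crossing_mulg1 crossing_mulVg crossing_mulgV.

Definition crossing_gen (k : 'I_n.-1) : crossing_group :=
  ([ffun p => Posz (p == (strand k, strandS k))], tperm (strand k) (strandS k)).

(** Both sides of a relation make the same pairs of strands cross, in opposite orders, so the same
    basis vectors are added up. The permutation parts are settled by [braid_perm_rel]. *)
Lemma crossing_rel u v : braid_rel u v ->
  weval crossing_gen u = weval crossing_gen v.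
Proof.
move=> uv; have := braid_perm_rel uv.
have weval2 w : (weval crossing_gen w).2 =
    weval (fun i => tperm (strand i) (strandS i)) w.
  rewrite /weval; elim: w => [|p w IHw]; rewrite ?big_nil // !big_cons -IHw.
  by case: p => i [].
rewrite -!weval2 => e2.
suff e1 : (weval crossing_gen u).1 = (weval crossing_gen v).1.
  by rewrite [LHS]surjective_pairing e1 e2 -surjective_pairing.
have eqE (s : {perm 'I_n}) a b c d :
    ((s a, s b) == (c, d)) = ((a, b) == (s^-1 c, s^-1 d)).
  by rewrite !xpair_eqE !(can2_eq (permK s) (permKV s)).
case: uv {e2} => {u v}[i j ij|i j ij];
  rewrite /weval !big_cons !big_nil !mulg1;
  apply/ffunP=> -[a b]; rewrite !ffunE /= !eqE !tpermV.
  by rewrite !tpermD -?val_eqE /= 1?GRing.addrC //; lia.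
have -> : strand j = strandS i by apply/val_inj.
have ac : strandS i != strandS j by rewrite -val_eqE /= ij; lia.
have ab : strand i != strandS j by rewrite -val_eqE /= ij; lia.
have bc : strand i != strandS i by rewrite -val_eqE /=; lia.
have ex : tperm (strandS i) (strandS j) (strand i) = strand i.
  by rewrite tpermD // eq_sym.
have ez : tperm (strand i) (strandS i) (strandS j) = strandS j.
  by rewrite tpermD.
rewrite !(ex, ez, tpermL, tpermR).
suff rev3 (r s t : int) : (r + (s + t) = t + (s + r))%R by exact: rev3.
by lia.
Qed.
End CrossingGroup.

(** * Crossing numbers of braids *)

Section CrossingNumbers.
Local Open Scope group_scope.
Variable n : nat.
Implicit Types x y : braid n.

Definition crossing : braid n -> crossing_group n := pres_lift (@crossing_gen n).

Lemma crossing_monoid_morphism : monoid_morphism crossing.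
Proof. by split; [apply: pres_lift1|apply: pres_liftM]; apply: crossing_rel. Qed.

HB.instance Definition _ := isUMagmaMorphism.Build (braid n) (crossing_group n)
  crossing crossing_monoid_morphism.

Lemma braid_perm1 : braid_perm (1 : braid n) = 1.
Proof. exact: gmulf1. Qed.

Lemma braid_permM x y : braid_perm (x * y) = braid_perm x * braid_perm y.
Proof. exact: gmulfM. Qed.

Lemma braid_permV x : braid_perm x^-1 = (braid_perm x)^-1.
Proof. exact: gmulfV. Qed.

Lemma braid_permJ x y : braid_perm (x ^ y) = braid_perm x ^ braid_perm y.
Proof. exact: gmulfJ. Qed.

Lemma braid_permX x k : braid_perm (x ^+ k) = braid_perm x ^+ k.
Proof. exact: gmulfXn. Qed.

Lemma crossing1 : crossing 1 = 1.
Proof. exact: gmulf1. Qed.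

Lemma crossingM x y : crossing (x * y) = crossing x * crossing y.
Proof. exact: gmulfM. Qed.

Lemma crossingV x : crossing x^-1 = (crossing x)^-1.
Proof. exact: gmulfV. Qed.

Lemma crossing_perm x : (crossing x).2 = braid_perm x.
Proof.
elim/presented_ind: x => [|x y ex ey|x ex|i].
- by rewrite braid_perm1 crossing1.
- by rewrite braid_permM -ex -ey crossingM.
- by rewrite braid_permV -ex crossingV.
- by rewrite braid_perm_gen [crossing _]pres_lift_gen //; apply: crossing_rel.
Qed.

Definition lk x (i j : 'I_n) : int := (crossing x).1 (i, j).

Lemma lkM x y i j :
  (lk (x * y)%g i j = lk x i j + lk y (braid_perm x i) (braid_perm x j))%R.
Proof. by rewrite /lk crossingM ffunE crossing_perm. Qed.

Lemma lk1 i j : lk 1 i j = 0%R.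
Proof. by rewrite /lk crossing1 ffunE. Qed.

Lemma lkV x i j :
  (lk x^-1%g i j = - lk x ((braid_perm x)^-1%g i) ((braid_perm x)^-1%g j))%R.
Proof. by rewrite /lk crossingV ffunE crossing_perm. Qed.

Lemma lk_gen k i j :
  lk (braid_gen k) i j = Posz ((i == strand k) && (j == strandS k)).
Proof.
by rewrite /lk [crossing _]pres_lift_gen ?ffunE //; apply: crossing_rel.
Qed.

(** As [x] is pure, [y^-1] and [y] are read at the same pair of positions and their contributions
    cancel. *)
Lemma lkJ x y i j : braid_perm x = 1 ->
  lk (x ^ y) i j = lk x ((braid_perm y)^-1%g i) ((braid_perm y)^-1%g j).
Proof.
move=> x1; rewrite conjgE !lkM lkV braid_permV x1 !perm1; lia.
Qed.

Lemma crossing_eq1 x :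
  braid_perm x = 1 -> (forall i j, lk x i j = 0%R) -> crossing x = 1.
Proof.
move=> x1 x0; rewrite [LHS]surjective_pairing crossing_perm x1.
by congr pair; apply/ffunP=> -[i j]; rewrite [LHS]x0 ffunE.
Qed.

(** Both sides are additive along products, the right one by telescoping, so the generators
    decide. *)
Lemma lk_antisym x i j :
  (lk x i j - lk x j i =
     Posz (i < j) - Posz (braid_perm x i < braid_perm x j))%R.
Proof.
elim/presented_ind: x i j => [|x y ex ey|x ex|k] i j.
- by rewrite !lk1 braid_perm1 !perm1; lia.
- rewrite !lkM braid_permM !permM.
  by have := ex i j; have := ey (braid_perm x i) (braid_perm x j); lia.
- rewrite !lkV braid_permV.
  have := ex ((braid_perm x)^-1 i) ((braid_perm x)^-1 j).
  by rewrite !permKV; lia.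
- rewrite !lk_gen braid_perm_gen -!val_eqE /=.
  have tE (a : 'I_n) : tperm (strand k) (strandS k) a =
      (if a == k :> nat then k.+1 else if a == k.+1 :> nat then k : nat else a) :> nat.
    by rewrite permE /= -!val_eqE /=; case: ifP => // _; case: ifP.
  rewrite !tE.
  case: (eqVneq (i : nat) k); case: (eqVneq (j : nat) k);
    case: (eqVneq (i : nat) k.+1); case: (eqVneq (j : nat) k.+1); lia.
Qed.

End CrossingNumbers.

(** * Faithfulness of the permutation representation under the Coxeter relations *)

Section Coxeter.
Local Open Scope group_scope.
Variables (G : groupType) (M : nat) (s : nat -> G).
Hypothesis s_sqr : forall i, i <= M -> s i * s i = 1.
Hypothesis s_far : forall i j, i.+1 < j -> j <= M -> commute (s i) (s j).
Hypothesis s_near : forall i, i < M -> s i.+1 * s i * s i.+1 = s i * s i.+1 * s i.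

(** For [k <= M.+1] these positive words form the subgroup generated by [s 0, ..., s k.-1], the
    generators being involutions. *)
Inductive gen_below (k : nat) : G -> Prop :=
| gen_below1 : gen_below k 1
| gen_belowS x i : i < k -> gen_below k x -> gen_below k (x * s i).

Lemma gen_belowM k x y : gen_below k x -> gen_below k y -> gen_below k (x * y).
Proof.
move=> Hx; elim=> [|{}y i ik _ IHy]; first by rewrite mulg1.
by rewrite mulgA; apply: gen_belowS.
Qed.

Lemma gen_below_s k i : i < k -> gen_below k (s i).
Proof. by move=> ik; rewrite -[s i]mul1g; apply: gen_belowS => //; apply: gen_below1. Qed.

Lemma gen_belowV k x : k <= M.+1 -> gen_below k x -> gen_below k x^-1.
Proof.
move=> kM; elim=> [|{}x i ik _ IHx]; first by rewrite invg1; apply: gen_below1.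
rewrite invgM; apply: gen_belowM => //.
by rewrite (mulg1_eq (s_sqr (leq_trans ik kM))); apply: gen_below_s.
Qed.

(* [desc k d] is [s k * s k.-1 * ...] with [d] factors; for [d <= k.+1] these are
   the minimal coset representatives of S_(k+1) in S_(k+2). *)
Fixpoint desc (k d : nat) : G := if d is e.+1 then desc k e * s (k - e) else 1.

Lemma desc_far k d i : k <= M -> i + d < k -> commute (desc k d) (s i).
Proof.
move=> kM; elim: d => [|d IHd] idk /=; first exact/commute_sym/commute1.
apply/commute_sym/commuteM; apply/commute_sym; first by apply: IHd; lia.
by apply/commute_sym/s_far; lia.
Qed.

(** The letter [s i.+1] commutes leftwards up to the factors [s i.+1 * s i]; there the braid
    relation turns it into a leading [s i], which commutes with all earlier factors. *)
Lemma desc_shift k d i : k <= M -> i < k -> k < i + d -> d <= k.+1 ->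
  desc k d * s i.+1 = s i * desc k d.
Proof.
move=> kM ik; elim: d => [|d IHd] kid dk; first by lia.
have [kid'|kid'] := ltnP k (i + d).
  rewrite /= -mulgA (s_far (i := k - d)); [|lia|lia].
  by rewrite mulgA IHd ?mulgA //; lia.
case: d {IHd} kid dk kid' => [|d] kid dk kid'; first by lia.
have -> : desc k d.+2 = desc k d * s i.+1 * s i.
  by rewrite /=; congr (_ * s _ * s _); lia.
rewrite -!mulgA [s i.+1 * _]mulgA s_near; last by lia.
by rewrite !mulgA desc_far //; lia.
Qed.

(** A letter [s i] appended to [y * desc k d] commutes into [y] if [i + d < k], lengthens [desc] if
    [i + d = k], cancels its last factor if [i + d = k.+1], and otherwise passes into [y] as
    [s i.-1]. *)
Lemma gen_below_coset k x : k <= M -> gen_below k.+1 x ->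
  exists y d, [/\ gen_below k y, d <= k.+1 & x = y * desc k d].
Proof.
move=> kM; elim=> [|{}x i ik _ [y [d [Hy dk ->]]]].
  by exists 1, 0; split; rewrite ?mulg1 //; apply: gen_below1.
have [ikd|ikd|ikd] := ltngtP (i + d) k.
- exists (y * s i), d; split=> //; first by apply: gen_belowS => //; lia.
  by rewrite -!mulgA desc_far.
- case: (eqVneq (i + d) k.+1) => ikd'.
    case: d dk ikd ikd' => [|d] dk ikd ikd'; first by lia.
    exists y, d; split=> //; first by lia.
    have -> : i = k - d by lia.
    by rewrite /= -!mulgA s_sqr ?mulg1 //; lia.
  case: i ik ikd ikd' => [|i] ik ikd ikd'; first by lia.
  exists (y * s i), d; split=> //; first by apply: gen_belowS => //; lia.
  by rewrite -!mulgA desc_shift //; lia.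
- exists y, d.+1; split=> //; first by lia.
  by rewrite /= -!mulgA; congr (_ * (_ * s _)); lia.
Qed.

Variable p : G -> {perm 'I_M.+2}.
Hypothesis p1 : p 1 = 1.
Hypothesis pM : {morph p : x y / x * y}.
Hypothesis p_s : forall i, i <= M -> p (s i) = tperm (inord i) (inord i.+1).

Lemma gen_below_fix k x (j : 'I_M.+2) : k <= M.+1 -> gen_below k x -> k < j -> p x j = j.
Proof.
move=> kM Hx kj; elim: Hx => [|{}x i ik _ IHx]; first by rewrite p1 perm1.
by rewrite pM p_s ?permM ?IHx ?tpermD // -?val_eqE /= ?inordK; lia.
Qed.

Lemma desc_perm k d : k <= M -> d <= k.+1 -> p (desc k d) (inord k.+1) = inord (k.+1 - d).
Proof.
move=> kM; elim: d => [|d IHd] dk /=; first by rewrite p1 perm1 subn0.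
rewrite pM permM IHd ?p_s; [|lia|lia].
have -> : (k - d).+1 = k.+1 - d by lia.
by rewrite tpermR; congr inord; lia.
Qed.

(** Write [x = y * desc k d]. Since [y] fixes the point [k.+1], [x] sends it to [k.+1 - d]; a
    trivial permutation forces [d = 0], and induction applies to [y]. *)
Lemma gen_below_faithful k x : k <= M.+1 -> gen_below k x -> p x = 1 -> x = 1.
Proof.
elim: k x => [|k IHk] x kM Hx; first by case: Hx.
have [//|y [d [Hy dk ->]]] := gen_below_coset _ Hx.
move=> p_yd; have := congr1 (fun w : {perm _} => val (w (inord k.+1))) p_yd.
rewrite pM permM perm1 (gen_below_fix _ Hy); [|lia|by rewrite inordK; lia].
rewrite desc_perm //= !inordK; [|lia|lia] => kd.
have d0 : d = 0 by lia.
rewrite d0 /= mulg1; apply: IHk => //; first by lia.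
by rewrite -p_yd d0 /= mulg1.
Qed.

End Coxeter.

(** * The pure braid group as the normal closure of the squared generators *)

Section Kernel.
Local Open Scope group_scope.
Variable M : nat.
Notation B := (braid M.+2).
Implicit Types x y z : B.

Definition sig (i : nat) : B := braid_gen (inord i : 'I_M.+2.-1).

Lemma sig_far i j : i.+1 < j -> j <= M -> commute (sig i) (sig j).
Proof.
move=> ij jM; rewrite /commute.
rewrite [LHS]pres_mulE [RHS]pres_mulE; apply/pres_piP/pres_rel/braid_far.
by rewrite /= !inordK ?ij //; lia.
Qed.

Lemma sig_near i : i < M -> sig i.+1 * sig i * sig i.+1 = sig i * sig i.+1 * sig i.
Proof.
move=> iM; rewrite -!mulgA.
rewrite [X in _ * X]pres_mulE [X in _ = _ * X]pres_mulE.
rewrite [LHS]pres_mulE [RHS]pres_mulE; apply/pres_piP/pres_rel.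
by apply: braid_near; rewrite !inordK; lia.
Qed.

Lemma sig_perm i : i <= M -> braid_perm (sig i) = tperm (inord i) (inord i.+1).
Proof.
move=> iM; rewrite braid_perm_gen.
by congr tperm; apply/val_inj; rewrite /= !inordK; lia.
Qed.

Lemma sig_ind (P : B -> Prop) :
  P 1 -> (forall x y, P x -> P y -> P (x * y)) -> (forall x, P x -> P x^-1) ->
  (forall i, i <= M -> P (sig i)) -> forall x, P x.
Proof.
move=> P1 PM PV Ps; apply: presented_ind => // a.
by have := Ps a (ltn_ord a); rewrite /sig inord_val.
Qed.

Section PermLift.
Variable H : B -> Prop.
Hypothesis H1 : H 1.
Hypothesis HM : forall x y, H x -> H y -> H (x * y).
Hypothesis HV : forall x, H x -> H x^-1.

Lemma ascending_lift k d : k <= M.+1 -> d <= k -> (forall i, i < k -> H (sig i)) ->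
  exists u, [/\ H u, braid_perm u (inord (k - d)) = inord k
    & forall j : 'I_M.+2, k < j -> braid_perm u j = j].
Proof.
move=> kM dk Hs; elim: d dk => [|d IHd] dk.
  by exists 1; split=> // [|j _]; rewrite braid_perm1 perm1 ?subn0.
have [|u [Hu ud ufix]] := IHd; first by lia.
exists (sig (k - d.+1) * u); split; first by apply: HM => //; apply: Hs; lia.
  rewrite braid_permM permM sig_perm; last by lia.
  by rewrite tpermL subnSK.
move=> j kj; rewrite braid_permM permM sig_perm; last by lia.
by rewrite tpermD ?ufix // -val_eqE /= inordK; lia.
Qed.

(** The subgroup [H] is kept general: the whole group gives surjectivity, and the centralizer of the
    last generator serves in [top_twist_fix]. *)
Lemma perm_lift k (w : {perm 'I_M.+2}) : k <= M.+2 ->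
  (forall i, i.+1 < k -> H (sig i)) ->
  (forall j : 'I_M.+2, k <= j -> w j = j) ->
  exists2 b, H b & braid_perm b = w.
Proof.
elim: k w => [|k IHk] w kM Hs wfix.
  exists 1 => //; rewrite braid_perm1.
  by apply/permP=> j; rewrite perm1 wfix.
pose k' : 'I_M.+2 := inord k.
have k'E : k' = k :> nat by rewrite inordK.
have wk : w k' <= k.
  rewrite leqNgt; apply/negP=> kw; have /perm_inj := wfix _ kw.
  by move/(congr1 val) => /=; lia.
(* The braid [u] carries [w k'] to [k], so [w * braid_perm u] fixes [k] and falls under the
   induction hypothesis. *)
have [|u [Hu uk ufix]] := ascending_lift (d := k - w k') kM _ Hs; first exact: leq_subr.
rewrite subKn // inord_val in uk.
have [|||b Hb bw] := IHk (w * braid_perm u); first by lia.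
- by move=> i ik; apply: Hs; lia.
- move=> j kj; rewrite permM; have [<-|jk] := eqVneq k' j; first by rewrite uk.
  have {}kj : k < j by move: jk; rewrite -val_eqE /= k'E; lia.
  by rewrite wfix ?ufix.
exists (b * u^-1); first by apply: HM => //; apply: HV.
by rewrite braid_permM braid_permV bw mulgK.
Qed.

End PermLift.

Lemma braid_perm_surj (w : {perm 'I_M.+2}) : exists b : B, braid_perm b = w.
Proof.
have [//|//|//|//|//|j|b _ bw] := @perm_lift (fun=> True) _ _ _ M.+2 w.
  by rewrite leqNgt ltn_ord.
by exists b.
Qed.

Inductive square_closure : B -> Prop :=
| square_closureJ i g : i <= M -> square_closure ((sig i * sig i) ^ g)
| square_closure1 : square_closure 1
| square_closureM x y : square_closure x -> square_closure y -> square_closure (x * y)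
| square_closureV x : square_closure x -> square_closure x^-1.

Lemma square_closure_normal x y : square_closure x -> square_closure (x ^ y).
Proof.
elim=> [i g iM||u v _ Hu _ Hv|u _ Hu].
- by rewrite -conjgM; apply: square_closureJ.
- by rewrite conj1g; apply: square_closure1.
- by rewrite conjMg; apply: square_closureM.
- by rewrite conjVg; apply: square_closureV.
Qed.

Definition square_subgroup : normal_subgroup B :=
  NormalSubgroup square_closure1 square_closureM square_closureV
    square_closure_normal.

Lemma square_closure_pure x : square_closure x -> braid_perm x = 1.
Proof.
elim=> [i g iM||u v _ Hu _ Hv|u _ Hu].
- by rewrite braid_permJ braid_permM sig_perm // tperm2 conj1g.
- exact: braid_perm1.
- by rewrite braid_permM Hu Hv mulg1.
- by rewrite braid_permV Hu invg1.
Qed.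

(* The quotient of the braid group by the squares of the generators satisfies
   the Coxeter relations, hence maps faithfully to permutations. *)
Lemma pure_square_closure x : braid_perm x = 1 -> square_closure x.
Proof.
pose pi := quot_pi square_subgroup; pose s i := pi (sig i).
have piM : {morph pi : x y / x * y} by apply: quot_piM.
have pi_eq1 y : pi y = 1 <-> square_closure y.
  rewrite -[1]/(pi 1); split=> [/esym/quot_piP|Hy].
    by rewrite invg1 mul1g.
  by apply/esym/quot_piP; rewrite invg1 mul1g.
have s_sqr i : i <= M -> s i * s i = 1.
  move=> iM; rewrite -piM; apply/pi_eq1.
  by rewrite -[X in square_closure X]conjg1; apply: square_closureJ.
have s_far i j : i.+1 < j -> j <= M -> commute (s i) (s j).
  by move=> ij jM; rewrite /commute -!piM (sig_far ij jM).
have s_near i : i < M -> s i.+1 * s i * s i.+1 = s i * s i.+1 * s i.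
  by move=> /sig_near /(congr1 pi); rewrite !piM.
have gen y : gen_below s M.+1 (pi y).
  elim/sig_ind: y => [|y z Hy Hz|y Hy|i iM].
  - exact: gen_below1.
  - by rewrite piM; apply: gen_belowM.
  - by rewrite [pi _]gmulfV; apply: (gen_belowV (M := M)).
  - exact: gen_below_s.
pose p := quot_lift (N := square_subgroup) (@braid_perm M.+2).
have fN := square_closure_pure.
have p_pi y : p (pi y) = braid_perm y by apply: quot_liftE.
move=> x1; apply/pi_eq1.
apply: (gen_below_faithful s_sqr s_far s_near (p := p) _ _ _ (leqnn M.+1)) => //.
- exact: quot_lift1.
- exact: quot_liftM.
- by move=> i iM; rewrite p_pi sig_perm.
- by rewrite p_pi.
Qed.

End Kernel.

(** * Reordering products of commuting factors *)

Section CommutingProducts.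
Local Open Scope group_scope.

(** Only the factors commute, not the whole group, so the permutation is split into exchanges of
    adjacent blocks. *)
Lemma prodg_perm_eq (G : groupType) (T : eqType) (f : T -> G) (u v : seq T) :
  (forall x y, commute (f x) (f y)) -> perm_eq u v ->
  \prod_(x <- u) f x = \prod_(x <- v) f x.
Proof.
move=> fC uv; pose P s := \prod_(x <- u) f x = \prod_(x <- s) f x.
apply: (@catCA_perm_ind _ P _ u v) => // s1 s2 s3; rewrite /P => ->.
rewrite !big_cat /= !mulgA; congr (_ * _).
by apply: commute_prod => x _; apply/commute_sym/commute_prod.
Qed.

End CommutingProducts.

(** * Pure braids modulo commutators *)

Section PureQuotient.
Local Open Scope group_scope.
Variable n : nat.
Implicit Types x y : braid n.

Lemma braid_piM x y : braid_pi (x * y) = braid_pi x * braid_pi y.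
Proof. exact: gmulfM. Qed.

Lemma braid_piV x : braid_pi x^-1 = (braid_pi x)^-1.
Proof. exact: gmulfV. Qed.

Lemma braid_piX x k : braid_pi (x ^+ k) = braid_pi x ^+ k.
Proof. exact: gmulfXn. Qed.

Lemma braid_piJ x y : braid_pi (x ^ y) = braid_pi x ^ braid_pi y.
Proof. exact: gmulfJ. Qed.

Lemma braid_pi_eq1 x : braid_pi x = 1 <-> derived (@pure_braid n) x.
Proof.
rewrite -[1]/(braid_pi 1); split=> [/esym/quot_piP|Hx].
  by rewrite invg1 mul1g.
by apply/esym/quot_piP; rewrite invg1 mul1g.
Qed.

Lemma pure_commute x y : braid_perm x = 1 -> braid_perm y = 1 ->
  commute (braid_pi x) (braid_pi y).
Proof.
move=> x1 y1; apply/commgP/eqP.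
by rewrite -[LHS](gmulfR (@braid_pi n)); apply/braid_pi_eq1/derivedR.
Qed.

(** On pure braids [lk] is additive, hence vanishes on commutators. *)
Lemma derived_crossing x : derived (@pure_braid n) x -> crossing x = 1.
Proof.
elim=> [y z Py Pz||y z _ ey _ ez|y _ ey].
- apply: crossing_eq1 => [|i j].
    by rewrite commgEl braid_permM braid_permJ braid_permV Py invg1 conj1g mulg1.
  rewrite commgEl lkM lkJ // lkV braid_permV Py Pz invg1 !perm1; lia.
- exact: crossing1.
- by rewrite crossingM ey ez mulg1.
- by rewrite crossingV ey invg1.
Qed.

End PureQuotient.

(** * Full twists of pairs of strands, and faithfulness of crossing numbers *)

Section FullTwists.
Local Open Scope group_scope.
Variable M : nat.
Notation B := (braid M.+2).
Notation q := (@braid_pi M.+2).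
Implicit Types x y z : B.

Let lo : 'I_M.+2 := inord M.
Let hi : 'I_M.+2 := inord M.+1.

Lemma lo_neq_hi : lo != hi.
Proof. by rewrite -val_eqE /= !inordK; lia. Qed.

Definition top_twist : B := sig M M * sig M M.

Lemma braid_perm_top_twist : braid_perm top_twist = 1.
Proof. by rewrite braid_permM sig_perm // tperm2. Qed.

Lemma braid_perm_top_twistJ g : braid_perm (top_twist ^ g) = 1.
Proof. by rewrite braid_permJ braid_perm_top_twist conj1g. Qed.

(* A permutation fixing the last two strands lifts to a braid on the other
   strands, which commutes with [sig M M]. *)
Lemma top_twist_fix z : braid_perm z lo = lo -> braid_perm z hi = hi ->
  q (top_twist ^ z) = q top_twist.
Proof.
move=> zlo zhi.
have [||||i iM|j Mj|b Hb bz] :=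
    @perm_lift M (fun x => commute (sig M M) x) _ _ _ M (braid_perm z).
- exact: commute1.
- by move=> x y; apply: commuteM.
- by move=> x; apply: commuteV.
- by lia.
- by apply/commute_sym/sig_far.
- have [->//|->//] : j = lo \/ j = hi.
  have := ltn_ord j; rewrite ltnS leq_eqVlt => /orP[/eqP jM|jM].
    by right; apply/val_inj; rewrite /= inordK.
  by left; apply/val_inj; rewrite /= inordK; lia.
have -> : z = (z * b^-1) * b by rewrite mulgVK.
rewrite conjgM braid_piJ.
have -> : q (top_twist ^ (z * b^-1)) = q top_twist.
  rewrite braid_piJ; apply/conjg_fixP/commgP/pure_commute.
    exact: braid_perm_top_twist.
  by rewrite braid_permM braid_permV bz mulgV.
rewrite -braid_piJ; congr q; apply/conjg_fixP/commgP.
by apply/commute_sym/commuteM; apply/commute_sym.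
Qed.

(** Conjugators agreeing on [lo] and [hi] differ by a left factor fixing both, covered by
    [top_twist_fix]. The swapped case reduces to this one through [sig M M], which commutes with its
    own square. *)
Lemma top_twist_conj x y :
  (braid_perm x lo, braid_perm x hi) \in
    [:: (braid_perm y lo, braid_perm y hi); (braid_perm y hi, braid_perm y lo)] ->
  q (top_twist ^ x) = q (top_twist ^ y).
Proof.
have wlog_xy z : braid_perm z lo = braid_perm y lo ->
    braid_perm z hi = braid_perm y hi -> q (top_twist ^ z) = q (top_twist ^ y).
  move=> zlo zhi; have -> : z = (z * y^-1) * y by rewrite mulgVK.
  rewrite conjgM !(braid_piJ _ y) top_twist_fix //.
    by rewrite braid_permM braid_permV permM zlo permK.
  by rewrite braid_permM braid_permV permM zhi permK.
rewrite !inE => /orP[] /eqP[xlo xhi]; first exact: wlog_xy.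
rewrite -(wlog_xy (sig M M * x)) ?conjgM.
- by rewrite [top_twist ^ sig M M]conjgE /top_twist mulgA mulKg.
- by rewrite braid_permM sig_perm // permM tpermL xhi.
- by rewrite braid_permM sig_perm // permM tpermR xlo.
Qed.

(** By the braid relation, conjugation by [sig M j * sig M j.+1] turns [sig M j.+1] into [sig M j];
    the index thus descends from [M] to [i]. *)
Lemma sig_conj i : i <= M -> exists d : B,
  [/\ sig M i = sig M M ^ d, braid_perm d lo = inord i
    & braid_perm d hi = inord i.+1].
Proof.
move=> iM; rewrite -(subKn iM); elim: (M - i) (leq_subr i M) => [|k IHk] kM.
  by exists 1; rewrite conjg1 braid_perm1 !perm1 subn0.
have [|d [ed dlo dhi]] := IHk; first by lia.
set j := M - k.+1; have jE : M - k = j.+1 by rewrite /j; lia.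
have jM : j < M by rewrite /j; lia.
rewrite jE in ed dlo dhi.
exists (d * (sig M j * sig M j.+1)); split.
- rewrite conjgM -ed conjgE; apply: (mulgI (sig M j * sig M j.+1)).
  by rewrite mulVKg mulgA sig_near // mulgA.
- rewrite !braid_permM !permM dlo !sig_perm //; last by lia.
  by rewrite tpermR tpermD // -val_eqE /= !inordK; lia.
- rewrite !braid_permM !permM dhi !sig_perm //; last by lia.
  rewrite [X in tperm (inord j.+1) _ X]tpermD ?tpermR // -val_eqE /= !inordK; lia.
Qed.

(** The condition [i != j] stands under the existential so that [full_twist] can be chosen for every
    pair. *)
Lemma pair_lift (i j : 'I_M.+2) :
  exists g : B, i != j -> braid_perm g lo = i /\ braid_perm g hi = j.
Proof.
pose w1 := tperm lo i; pose w2 := tperm (w1 hi) j.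
have [g gw] := braid_perm_surj (w1 * w2); exists g => ij.
rewrite gw !permM [w1 lo]tpermL tpermL tpermD //; last by rewrite eq_sym.
by rewrite -[X in _ != X](tpermL lo i) (inj_eq perm_inj) eq_sym lo_neq_hi.
Qed.

(** For distinct strands, a representative of the usual pure braid generator of the pair; by
    [top_twist_conj] its class does not depend on the chosen conjugator. *)
Definition full_twist (p : 'I_M.+2 * 'I_M.+2) : B :=
  top_twist ^ (projT1 (cid (pair_lift p.1 p.2))).

Lemma full_twist_pure p : braid_perm (full_twist p) = 1.
Proof. exact: braid_perm_top_twistJ. Qed.

Lemma lk_top_twist a b :
  lk top_twist a b = Posz ((a == lo) && (b == hi) || (a == hi) && (b == lo)).
Proof.
have sE : strand (inord M : 'I_M.+2.-1) = lo by apply/val_inj; rewrite /= !inordK.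
have sSE : strandS (inord M : 'I_M.+2.-1) = hi by apply/val_inj; rewrite /= !inordK.
rewrite lkM braid_perm_gen !lk_gen sE sSE !(can2_eq (tpermK _ _) (tpermK _ _)).
rewrite tpermL tpermR; have := lo_neq_hi.
rewrite -!val_eqE /= => lohi. lia.
Qed.

Lemma lk_top_twistJ g a b (i := braid_perm g lo) (j := braid_perm g hi) :
  lk (top_twist ^ g) a b = Posz ((a == i) && (b == j) || (a == j) && (b == i)).
Proof.
rewrite lkJ ?braid_perm_top_twist // lk_top_twist /i /j.
by rewrite !(can2_eq (permKV _) (permK _)).
Qed.

Lemma lk_full_twist (p : 'I_M.+2 * 'I_M.+2) a b : p.1 != p.2 ->
  lk (full_twist p) a b =
    Posz ((a == p.1) && (b == p.2) || (a == p.2) && (b == p.1)).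
Proof.
move=> p12; rewrite lk_top_twistJ; case: cid => g Hg /=.
by have [-> ->] := Hg p12.
Qed.

Lemma full_twistE g (i := braid_perm g lo) (j := braid_perm g hi) :
  q (top_twist ^ g) = q (full_twist (i, j)) /\
  q (top_twist ^ g) = q (full_twist (j, i)).
Proof.
have ij : i != j by rewrite (inj_eq perm_inj) lo_neq_hi.
split; apply: top_twist_conj; case: cid => h Hh /=.
  by have [-> ->] := Hh ij; rewrite !inE eqxx.
rewrite eq_sym in ij.
by have [-> ->] := Hh ij; rewrite !inE eqxx orbT.
Qed.

Definition upper := [pred p : 'I_M.+2 * 'I_M.+2 | p.1 < p.2].

Lemma upper_full_twist g : exists2 p, p \in upper &
  q (top_twist ^ g) = q (full_twist p) /\
  forall i j : 'I_M.+2, i < j -> lk (top_twist ^ g) i j = Posz (p == (i, j)).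
Proof.
have [e1 e2] := full_twistE g; set i := braid_perm g lo in e1 e2.
set j := braid_perm g hi in e1 e2.
have ij : i != j by rewrite (inj_eq perm_inj) lo_neq_hi.
have [ltij|ltji|/val_inj eij] := ltngtP i j; last by rewrite eij eqxx in ij.
- exists (i, j) => //; split=> // a b ab; rewrite lk_top_twistJ -/i -/j xpair_eqE.
  by rewrite -!val_eqE /=; lia.
- exists (j, i) => //; split=> // a b ab; rewrite lk_top_twistJ -/i -/j xpair_eqE.
  by rewrite -!val_eqE /=; lia.
Qed.

Definition full_twists (u : seq ('I_M.+2 * 'I_M.+2)) : braid_quot M.+2 :=
  \prod_(p <- u) q (full_twist p).

Lemma full_twists_commute u v : commute (full_twists u) (full_twists v).
Proof.
apply: commute_prod => p _; apply/commute_sym/commute_prod => p' _.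
by apply: pure_commute; apply: full_twist_pure.
Qed.

(** The lists [u] and [v] collect the twists with exponent 1 and -1. Restricting to pairs [i < j]
    gives each twist one name, so multiplicities can be read off from crossing numbers. *)
Lemma square_closure_full_twists x : square_closure x ->
  exists u v, [/\ all upper u, all upper v,
    q x = full_twists u * (full_twists v)^-1 &
    forall i j : 'I_M.+2, i < j ->
      lk x i j = (Posz (count_mem (i, j) u) - Posz (count_mem (i, j) v))%R].
Proof.
elim=> {x}[i g iM||x y Hx [u [v [Hu Hv ex lx]]] Hy [u' [v' [Hu' Hv' ey ly]]]|
           x Hx [u [v [Hu Hv ex lx]]]].
- have [d [ed _ _]] := sig_conj iM.
  have -> : (sig M i * sig M i) ^ g = top_twist ^ (d * g).
    by rewrite ed -conjMg conjgM.
  have [p Hp [ep lp]] := upper_full_twist (d * g).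
  exists [:: p], [::]; rewrite all_seq1 /full_twists big_seq1 big_nil invg1 mulg1.
  by split=> // a b ab; rewrite lp //= addn0; lia.
- exists [::], [::]; split=> //; first by rewrite /full_twists big_nil mulgV [LHS]gmulf1.
  by move=> i j _; rewrite lk1.
- exists (u ++ u'), (v ++ v'); split; rewrite ?all_cat ?Hu ?Hu' ?Hv ?Hv' //.
    rewrite braid_piM ex ey /full_twists !big_cat /= -!/(full_twists _) invgM.
    rewrite -!mulgA; congr (_ * _).
    have C : commute (full_twists v)^-1 (full_twists u' * (full_twists v')^-1).
      apply/commute_sym/commuteV/commute_sym/commuteM; first exact: full_twists_commute.
      exact/commuteV/full_twists_commute.
    by rewrite C -mulgA.
  move=> i j ij; rewrite lkM (square_closure_pure Hx) !perm1 lx // ly // !count_cat; lia.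
- exists v, u; split=> //; first by rewrite braid_piV ex invgM invgK.
  move=> i j ij; rewrite lkV (square_closure_pure Hx) invg1 !perm1 lx //; lia.
Qed.

Lemma crossing_faithful x : crossing x = 1 -> q x = 1.
Proof.
move=> x1; have px : braid_perm x = 1 by rewrite -crossing_perm x1.
have [u [v [Hu Hv -> lx]]] := square_closure_full_twists (pure_square_closure px).
(* Vanishing crossing numbers give every pair [i < j] the same multiplicity in [u] and [v], and
   other pairs occur in neither. *)
suff uv : perm_eq u v.
  rewrite /full_twists (prodg_perm_eq _ uv) ?mulgV // => p p'.
  by apply: pure_commute; apply: full_twist_pure.
apply/allP=> -[i j] _ /=; have [ij|ij] := boolP (i < j).
  by have := lx i j ij; rewrite /lk x1 ffunE => /esym/eqP; rewrite GRing.subr_eq0.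
have count0 w : all upper w -> count_mem (i, j) w = 0.
  move=> Hw; apply/count_memPn; apply: contra ij => /(allP Hw); exact.
by rewrite !count0.
Qed.

End FullTwists.

(** * Cycle types, orders and existence of permutations *)

Section CycleTypes.
Local Open Scope group_scope.
Variable T : finType.
Implicit Types (s : {perm T}) (cs : seq (seq T)).

Lemma porbit_fconnect s x y : (y \in porbit s x) = fconnect s x y.
Proof.
apply/porbitP/idP => [[i ->]|/iter_findex <-]; first by rewrite permX fconnect_iter.
by exists (findex s x y); rewrite permX.
Qed.

Lemma permX_fix s k x : ((s ^+ k) x == x) = (#|porbit s x| %| k)%N.
Proof.
set r := #|porbit s x|; have r0 : (0 < r)%N by rewrite lt0n card_porbit_neq0.
have rM q : (s ^+ (q * r)) x = x.
  elim: q => [|q IHq]; first by rewrite mul0n perm1.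
  by rewrite mulSn expgnDr permM [(s ^+ r) x]permX iter_porbit.
rewrite {1}(divn_eq k r) expgnDr permM rM.
have : (k %% r < r)%N by rewrite ltn_mod.
rewrite /dvdn; case: (k %% r)%N => [|j] jr; first by rewrite perm1 !eqxx.
apply/negP=> /eqP sj; have := uniq_traject_porbit s x; rewrite -/r => Ur.
have := nth_uniq x _ _ Ur; rewrite size_traject => /(_ j.+1 0 jr r0).
by rewrite !nth_traject //= -iterS -permX sj eqxx.
Qed.

Lemma mem_cycle_type s x : (1 < #|porbit s x|)%N -> #|porbit s x| \in cycle_type s.
Proof.
move=> x1; apply: map_f.
by rewrite mem_filter x1 mem_enum; apply: imset_f.
Qed.

Lemma cycle_typeP s k : k \in cycle_type s -> exists x, k = #|porbit s x|.
Proof.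
case/mapP=> X; rewrite mem_filter mem_enum => /andP[_ /imsetP[x _ ->]] ->.
by exists x.
Qed.

Lemma dvdn_biglcm_seq (ns : seq nat) k :
  reflect {in ns, forall i, i %| k} (\big[lcmn/1%N]_(i <- ns) i %| k).
Proof.
elim: ns => [|i ns IHns]; first by rewrite big_nil dvd1n; left.
rewrite big_cons dvdn_lcm; apply: (iffP andP) => [[ik /IHns nsk] j|nsk].
  by rewrite inE => /orP[/eqP-> //|/nsk].
split; first by apply: nsk; rewrite mem_head.
by apply/IHns=> j jns; apply: nsk; rewrite inE jns orbT.
Qed.

(** A point is fixed by [s ^+ k] exactly when the length of its orbit divides [k]; the omitted
    orbits have length 1, which always does. *)
Lemma expg_cycle_type s ns k : perm_eq (cycle_type s) ns ->
  s ^+ k = 1 <-> \big[lcmn/1%N]_(i <- ns) i %| k.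
Proof.
move=> sns; split=> [sk|/dvdn_biglcm_seq nsk].
  apply/dvdn_biglcm_seq=> i; rewrite -(perm_mem sns) => /cycle_typeP[x ->].
  by rewrite -permX_fix sk perm1.
apply/permP=> x; rewrite perm1; apply/eqP; rewrite permX_fix.
have := card_porbit_neq0 s x.
case: (ltngtP #|porbit s x| 1) => [|x1 _|->]; last by rewrite dvd1n.
  by rewrite ltnS leqn0 => /eqP->.
by apply: nsk; rewrite -(perm_mem sns) mem_cycle_type.
Qed.

Lemma perm_of_cycles cs : uniq (flatten cs) -> exists s,
  {in cs, forall c, {in c, s =1 next c}} /\
  (forall x, x \notin flatten cs -> s x = x).
Proof.
elim: cs => [|c cs IHcs] /=; first by exists 1; split=> // x _; rewrite perm1.
rewrite cat_uniq => /and3P[Uc /hasPn cU Ucs]; have [s [s_cs s_fix]] := IHcs Ucs.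
pose t := perm (can_inj (prev_next Uc)).
have tE x : t x = next c x by rewrite permE.
have t_fix x : x \notin c -> t x = x by move=> xc; rewrite tE next_nth (negPf xc).
exists (t * s); split=> [d|x]; last first.
  by rewrite mem_cat negb_or => /andP[xc xcs]; rewrite permM t_fix ?s_fix.
rewrite inE => /orP[/eqP->|d_cs] x xd; rewrite permM.
  rewrite tE s_fix //; apply/negP=> /cU /=.
  by rewrite mem_next xd.
rewrite t_fix ?(s_cs _ d_cs) //; apply: cU.
by apply/flattenP; exists d.
Qed.

Lemma cycle_type_of_cycles cs : uniq (flatten cs) -> {in cs, forall c, 1 < size c} ->
  exists s, perm_eq (cycle_type s) (map size cs).
Proof.
move=> Ucs cs1; have [s [s_cs s_fix]] := perm_of_cycles Ucs; exists s.
have U c : c \in cs -> uniq c.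
  move=> c_cs; case/splitPr: c_cs Ucs => ? ?.
  by rewrite flatten_cat cat_uniq /= cat_uniq => /and3P[_ _ /and3P[]].
have fc c : c \in cs -> fcycle s c.
  move=> c_cs; have := cycle_next (U _ c_cs).
  rewrite (@eq_in_cycle _ [in c] _ (frel s)) ?allss // => x y xc _ /=.
  by rewrite (s_cs _ c_cs).
have porbit_cycle c x : c \in cs -> x \in c -> porbit s x = [set y in c].
  move=> c_cs xc; apply/setP=> y; rewrite inE porbit_fconnect.
  exact: (fconnect_cycle (fc _ c_cs) xc).
have porbit_fix x : x \notin flatten cs -> #|porbit s x| = 1%N.
  by move=> xcs; apply/eqP; rewrite -dvdn1 -permX_fix expg1 s_fix.
have -> : map size cs = [seq #|X| | X : {set T} <- [seq [set y in c] | c : seq T <- cs]].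
  rewrite -map_comp; apply/eq_in_map=> c c_cs /=.
  by rewrite cardsE (card_uniqP (U _ c_cs)).
apply: perm_map; apply: uniq_perm; first by rewrite filter_uniq ?enum_uniq.
  (* The lists are nonempty and pairwise disjoint, so their underlying sets are distinct. *)
  elim: cs Ucs cs1 {s s_cs s_fix U fc porbit_cycle porbit_fix} => //= c cs IHcs.
  rewrite cat_uniq => /and3P[_ /hasPn cU Ucs] cs1.
  rewrite IHcs //; last by move=> d d_cs; apply: cs1; rewrite inE d_cs orbT.
  rewrite andbT; apply/mapP=> -[d d_cs /setP cd].
  have /cs1 : c \in c :: cs by rewrite mem_head.
  case: c cU cd {cs1} => // x c cU cd _.
  have xd : x \in d by have := cd x; rewrite !inE eqxx => <-.
  have /cU/= : x \in flatten cs by apply/flattenP; exists d.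
  by rewrite mem_head.
move=> X; rewrite mem_filter mem_enum.
apply/andP/mapP => [[X1 /imsetP[x _ eX]]|[c c_cs ->]].
  have [/flattenP[c c_cs xc]|xcs] := boolP (x \in flatten cs).
    by exists c => //; rewrite eX (porbit_cycle c).
  by rewrite eX porbit_fix in X1.
have [x xc] : exists x, x \in c.
  by case: c c_cs => [/cs1|x c] //; exists x; rewrite mem_head.
rewrite cardsE (card_uniqP (U _ c_cs)) cs1 //; split=> //.
by rewrite -(porbit_cycle c x) //; apply: imset_f.
Qed.

End CycleTypes.

(** The first [sumn ns] points are cut into consecutive blocks of the prescribed lengths, each
    turned into a cycle. *)
Lemma cycle_type_exists m (ns : seq nat) :
  (forall k, k \in ns -> 1 < k) -> \sum_(k <- ns) k <= m ->
  exists s : {perm 'I_m}, perm_eq (cycle_type s) ns.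
Proof.
move=> ns1; rewrite -sumnE => nsm.
pose l := take (sumn ns) (enum 'I_m).
have sz_l : size l = sumn ns by rewrite size_takel // size_enum_ord.
have shape_cs : shape (reshape ns l) = ns by rewrite reshapeKl ?sz_l.
have [||s] := @cycle_type_of_cycles _ (reshape ns l).
- by rewrite reshapeKr ?sz_l // take_uniq // enum_uniq.
- by move=> c c_cs; apply: ns1; rewrite -shape_cs; apply: map_f.
by rewrite -/(shape _) shape_cs; exists s.
Qed.

(** * Injectivity of the map induced by adding strands *)

Section Faithful.
Local Open Scope group_scope.

Lemma braid_pi_eq1_crossing n (x : braid n) : 1 < n ->
  braid_pi x = 1 <-> crossing x = 1.
Proof.
move=> n1; split=> [/braid_pi_eq1/derived_crossing//|].
case: n n1 x => [|[|M]] // _ x; exact: crossing_faithful.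
Qed.

Variables (n m : nat) (le_nm : n <= m).

Lemma iota_braidM (x y : braid n) :
  iota_braid le_nm (x * y) = iota_braid le_nm x * iota_braid le_nm y.
Proof. exact: gmulfM. Qed.

Lemma iota_braidV (x : braid n) :
  iota_braid le_nm x^-1 = (iota_braid le_nm x)^-1.
Proof. exact: gmulfV. Qed.

Lemma lk_iota (x : braid n) i j :
  lk (iota_braid le_nm x) (widen_ord le_nm i) (widen_ord le_nm j) = lk x i j.
Proof.
elim/presented_ind: x i j => [|x y ex ey|x ex|k] i j.
- have -> : iota_braid le_nm (1 : braid n) = 1 by exact: gmulf1.
  by rewrite !lk1.
- by rewrite iota_braidM !lkM ex !(iota_braid_perm le_nm x).1 ey.
- rewrite iota_braidV !lkV.
  have V a : (braid_perm (iota_braid le_nm x))^-1 (widen_ord le_nm a) =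
      widen_ord le_nm ((braid_perm x)^-1 a).
    apply: (@perm_inj _ (braid_perm (iota_braid le_nm x))).
    by rewrite (iota_braid_perm le_nm x).1 !permKV.
  by rewrite !V ex.
- by rewrite iota_braid_gen !lk_gen -!val_eqE.
Qed.

Lemma crossing_iota_eq1 (x : braid n) :
  crossing (iota_braid le_nm x) = 1 -> crossing x = 1.
Proof.
move=> x1; apply: crossing_eq1 => [|i j]; last by rewrite -lk_iota /lk x1 ffunE.
apply/permP=> k; rewrite perm1; apply/val_inj.
rewrite -[LHS]/(val (widen_ord le_nm _)) -(iota_braid_perm le_nm x).1.
by rewrite -crossing_perm x1 perm1.
Qed.

Lemma iota_quot_inj : 1 < n -> injective (@iota_quot n m le_nm).
Proof.
move=> n1 a b.
have piK (c : braid_quot n) : exists x, c = braid_pi x.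
  by exists (repr c); apply/esym/reprK.
have [[x ->] [y ->]] := (piK a, piK b); rewrite !iota_quotE => e.
apply: (mulgI (braid_pi x)^-1); rewrite mulVg -braid_piV -braid_piM.
apply/esym/braid_pi_eq1_crossing => //; apply: crossing_iota_eq1.
apply/braid_pi_eq1_crossing; first exact: leq_trans le_nm.
by rewrite iota_braidM iota_braidV braid_piM braid_piV e mulVg.
Qed.

End Faithful.

(** * Elements of finite order over permutations of odd order *)

Section Torsion.
Local Open Scope group_scope.

Lemma lk_diag n (x : braid n) i : lk x i i = 0%R.
Proof.
elim/presented_ind: x i => [|x y ex ey|x ex|k] i.
- exact: lk1.
- by rewrite lkM ex ey.
- by rewrite lkV ex.
- rewrite lk_gen -!val_eqE /=; lia.
Qed.

Lemma lk_pureX n (x : braid n) k : braid_perm x = 1 ->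
  braid_perm (x ^+ k) = 1 /\ forall i j, lk (x ^+ k) i j = (Posz k * lk x i j)%R.
Proof.
move=> px; elim: k => [|k [pk ek]].
  by rewrite braid_perm1; split=> // i j; rewrite lk1; lia.
by rewrite expgS braid_permM px pk mul1g; split=> // i j; rewrite lkM px !perm1 ek; lia.
Qed.

Lemma lk_pure_scale n (x : braid n) (c : int) : braid_perm x = 1 ->
  exists2 y, braid_perm y = 1 & forall i j, lk y i j = (c * lk x i j)%R.
Proof.
move=> px; case: c => k.
  by by have [] := lk_pureX k px; exists (x ^+ k).
exists (x ^+ k.+1)^-1 => [|i j]; have [pk ek] := lk_pureX k.+1 px.
  by rewrite braid_permV pk invg1.
by rewrite lkV pk invg1 !perm1 ek; lia.
Qed.

(** Powers of full twists realize the values at pairs [i < j] one at a time; the other values follow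
    since crossing numbers of a pure braid are symmetric and vanish on the diagonal. *)
Lemma lk_pure_surj n (d : 'I_n -> 'I_n -> int) : 1 < n ->
  (forall i j, d i j = d j i) -> (forall i, d i i = 0%R) ->
  exists2 x : braid n, braid_perm x = 1 & forall i j, lk x i j = d i j.
Proof.
case: n d => [|[|M]] // d _ dC d0.
suff lift (s : seq ('I_M.+2 * 'I_M.+2)) : exists2 x : braid M.+2, braid_perm x = 1 &
    forall i j : 'I_M.+2, i < j -> lk x i j = if (i, j) \in s then d i j else 0%R.
  have [x px ex] := lift (enum ([set: 'I_M.+2 * 'I_M.+2])).
  exists x => // i j; have [ij|ji|/val_inj->] := ltngtP i j.
  - by rewrite ex // mem_enum inE.
  - have := lk_antisym x i j; rewrite px !perm1 (ex _ _ ji) mem_enum inE dC; lia.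
  - by rewrite lk_diag d0.
elim: s => [|p s [x px ex]]; first by exists 1 => [|i j _]; rewrite ?braid_perm1 ?lk1.
have [p_upper|p_lower] := boolP ((p.1 < p.2) && (p \notin s)); last first.
  exists x => // i j ij; rewrite ex // inE; case: eqVneq p_lower => //= <-.
  by rewrite ij /= negbK => ->.
case/andP: p_upper => p12 ps.
have [y py ey] := lk_pure_scale (d p.1 p.2) (full_twist_pure p).
exists (x * y) => [|i j ij]; first by rewrite braid_permM px py mul1g.
rewrite lkM px !perm1 ex // ey lk_full_twist -?val_eqE ?neq_ltn ?p12 //.
have pE : ((i, j) == p) = (i == p.1) && (j == p.2).
  by rewrite [p in LHS]surjective_pairing xpair_eqE.
rewrite inE pE; have -> : (i == p.2) && (j == p.1) = false.
  by apply/negP=> /andP[/eqP ip /eqP jp]; move: ij p12; rewrite ip jp; lia.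
have [/andP[/eqP-> /eqP->]|_] := boolP ((i == p.1) && (j == p.2)) => /=.
  by rewrite -surjective_pairing (negPf ps); lia.
by case: ifP => _; lia.
Qed.

(* A permutation of odd order preserves a tournament: orient [{i, j}] according
   to the majority of the comparisons of [w^k i] with [w^k j]. *)
Lemma invariant_tournament n (w : {perm 'I_n}) : odd #[w] ->
  exists t : 'I_n -> 'I_n -> bool,
    (forall i j, i != j -> t j i = ~~ t i j) /\ (forall i j, t (w i) (w j) = t i j).
Proof.
move=> Ow; pose cmp i j k : nat := (w ^+ k) i < (w ^+ k) j.
pose c i j := \sum_(k < #[w]) cmp i j k.
exists (fun i j => #[w] < (c i j).*2); split=> i j.
  move=> ij; have : c i j + c j i = #[w].
    rewrite -big_split -[RHS]card_ord -sum1_card; apply: eq_bigr => k _ /=.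
    have : (w ^+ k) i != (w ^+ k) j by rewrite (inj_eq perm_inj).
    by rewrite -val_eqE /cmp /=; lia.
  (* The odd total excludes a tie, so exactly one of the two counts exceeds half. *)
  by move: Ow; lia.
suff -> : c (w i) (w j) = c i j by [].
have cw k : cmp (w i) (w j) k = cmp i j k.+1 by rewrite /cmp expgS !permM.
have cN : cmp i j #[w] = cmp i j 0 by rewrite /cmp expg_order.
rewrite /c; under eq_bigr do rewrite cw.
case: #[w] Ow cN => // N _ cN.
by rewrite big_ord_recr big_ord_recl /= cN addnC.
Qed.

(** Any lift [y] of [w] is multiplied by a pure braid [a] chosen so that the crossing numbers of
    [a * y] form a coboundary. *)
Lemma odd_order_lift n (w : {perm 'I_n}) : 1 < n -> odd #[w] ->
  exists2 x : braid n, braid_perm x = w & braid_pi (x ^+ #[w]) = 1.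
Proof.
move=> n1 /invariant_tournament [t [tC tw]].
have [y yw] : exists y : braid n, braid_perm y = w.
  by case: n n1 w {t tC tw} => [|[|M]] // _ w; apply: braid_perm_surj.
pose f (i j : 'I_n) := Posz ((i < j) && ~~ t i j).
(* Crossing numbers equal to the coboundary [v] make the lift conjugate to
   [(0, w)] in the crossing group. *)
pose v i j := (f i j - f (w i) (w j))%R.
have f_antisym i j : i != j -> (f i j - f j i = Posz (i < j) - Posz (t i j))%R.
  move=> ij; rewrite /f (tC i j ij); move: ij; rewrite -val_eqE /=.
  by case: (t i j); lia.
have [|i j|i|a pa ea] := @lk_pure_surj n (fun i j => v i j - lk y i j)%R.
- by [].
(* The correction is symmetric: [v] and [lk y] both have antisymmetric part [[i < j] - [w i < w j]],
   the terms in [t] cancelling by invariance. *)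
- have [->//|ij] := eqVneq i j.
  have := lk_antisym y i j; have := f_antisym i j ij.
  have := f_antisym (w i) (w j); rewrite (inj_eq perm_inj) => /(_ ij).
  rewrite yw tw /v; lia.
- by rewrite lk_diag /v /f !ltnn.
have pw : braid_perm (a * y) = w by rewrite braid_permM pa mul1g.
exists (a * y) => //; apply/braid_pi_eq1_crossing => //.
(* The crossing numbers of powers telescope, and vanish once [w ^+ k = 1]. *)
have X k : braid_perm ((a * y) ^+ k) = w ^+ k /\
    forall i j, lk ((a * y) ^+ k) i j = (f i j - f ((w ^+ k)%g i) ((w ^+ k)%g j))%R.
  elim: k => [|k [pk ek]].
    by rewrite braid_perm1; split=> // i j; rewrite lk1 !perm1; lia.
  rewrite expgSr braid_permM pk pw expgSr; split=> // i j.
  rewrite lkM pk ek lkM pa !perm1 ea !permM /v.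
  by rewrite GRing.subrK GRing.addrA GRing.subrK.
have [pN eN] := X #[w]; rewrite expg_order in pN eN.
by apply: crossing_eq1 => // i j; rewrite eN !perm1; lia.
Qed.

Lemma torsion_exists m (ns : seq nat) : 1 < m ->
  (forall k, k \in ns -> odd k /\ 3 <= k) -> \sum_(k <- ns) k <= m ->
  exists x : braid_quot m, has_order x (\big[lcmn/1%N]_(k <- ns) k) /\
    perm_eq (cycle_type (braid_quot_perm x)) ns.
Proof.
move=> m1 ns3 nsm; set N := \big[lcmn/1%N]_(k <- ns) k.
have [|w w_ns] := @cycle_type_exists m ns _ nsm.
  by move=> k /ns3[_]; apply: leq_trans.
have wN k : w ^+ k = 1 <-> N %| k by apply: expg_cycle_type.
have oN : #[w] = N.
  apply/eqP; rewrite eqn_dvd; apply/andP; split; last exact/wN/expg_order.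
  by rewrite order_dvdn; apply/eqP/wN.
have odd_N : odd N.
  rewrite /N big_seq.
  apply: (big_ind (fun k => odd k)) => // [a b a_odd b_odd|k /ns3[]//].
  (* The least common multiple divides the odd product [a * b]. *)
  apply: (@dvdn_odd _ (a * b)%N); last by rewrite oddM a_odd b_odd.
  by rewrite dvdn_lcm dvdn_mulr ?dvdn_mull.
have [|x xw xN] := odd_order_lift m1 (w := w); first by rewrite oN.
exists (braid_pi x); rewrite braid_quot_permE xw; split=> //; split.
- by rewrite -oN order_gt0.
- by rewrite -oN -[RHS]xN [RHS]braid_piX.
(* A trivial power has a trivial permutation, so the order of [w] bounds that of the lift from
   below. *)
- move=> j /andP[j0 jN] xj; suff : N %| j by move/(dvdn_leq j0); rewrite leqNgt jN.
  apply/wN; rewrite -xw -braid_permX -braid_quot_permE braid_piX xj.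
  by rewrite -[1]/(braid_pi 1) braid_quot_permE braid_perm1.
Qed.

End Torsion.

Unset Implicit Arguments.

Theorem theorem3 (m n : nat) (le2n : 2 <= n) (le_nm : n <= m) :
  (* (a) *)
  injective (@iota_quot n m le_nm)
  /\
  (* (b) *)
  (3 <= n -> odd n ->
     (exists x : braid_quot m, has_order x n) /\
     (exists x : braid_quot m,
        has_order x n /\ perm_eq (cycle_type (braid_quot_perm x)) [:: n]))
  /\
  (* (c) *)
  (forall ns : seq nat,
     (forall k, k \in ns -> odd k /\ 3 <= k) ->
     \sum_(k <- ns) k <= m ->
     (exists x : braid_quot m, has_order x (\big[lcmn/1]_(k <- ns) k)) /\
     (exists x : braid_quot m,
        has_order x (\big[lcmn/1]_(k <- ns) k) /\
        perm_eq (cycle_type (braid_quot_perm x)) ns)).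
Proof.
have m1 : 1 < m := leq_trans le2n le_nm.
have c ns (ns3 : forall k, k \in ns -> odd k /\ 3 <= k) (nsm : \sum_(k <- ns) k <= m) :
    (exists x : braid_quot m, has_order x (\big[lcmn/1]_(k <- ns) k)) /\
    (exists x : braid_quot m, has_order x (\big[lcmn/1]_(k <- ns) k) /\
        perm_eq (cycle_type (braid_quot_perm x)) ns).
  have [x [x_order x_type]] := torsion_exists m1 ns3 nsm.
  by split; exists x.
split; [exact: iota_quot_inj | split=> [n3 n_odd|//]].
(* An [n]-cycle is the case of the one-element list. *)
have := c [:: n]; rewrite !big_seq1; apply=> // k.
by rewrite inE => /eqP->.
Qed.
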